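(* The series $$\sum_{n=1}^{\infty} \frac{1}{n^3 \sin^2 n}$$ converges if and only if $$\sum_{k=1}^{\infty} \frac{a_{k+1}^2}{q_k} < \infty,$$ where $a_1, a_2, \ldots$ are the partial quotients of the continued fraction of $1/\pi$ and $q_k$ are the corresponding convergent denominators.
   Context: The (infinite, simple) continued fraction of $1/\pi$ is written $1/\pi = [0; a_1, a_2, a_3, \ldots]$ with positive integers $a_k$. Its convergents are $p_k/q_k$, with denominators given by $q_0 = 1$, $q_1 = a_1$, and $q_{k+1} = a_{k+1} q_k + q_{k-1}$ for $k \geq 1$. *)

(* Defs.v *)
From HB Require Import structures.
From mathcomp Require Import all_boot all_order all_algebra.
From mathcomp Require Import archimedean.
From mathcomp Require Import boolp classical_sets functions reals ereal topology.
From mathcomp Require Import normedtype sequences trigo pi_irrational.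
From mathcomp Require Import zify ring lra.

Set Implicit Arguments.
Unset Strict Implicit.
Unset Printing Implicit Defensive.

Import Order.TTheory GRing.Theory Num.Theory.
Import numFieldNormedType.Exports.

Local Open Scope classical_set_scope.
Local Open Scope ring_scope.

(* If x is rational, some complete quotient is an integer and the later ones
   are all equal to 0 because 0^-1 = 0; only irrational x are of interest. *)
Fixpoint complete_quotient (R : realType) (x : R) (k : nat) : R :=
  if k is j.+1 then
    (complete_quotient x j - (Num.floor (complete_quotient x j))%:~R)^-1
  else x.

Definition partial_quotient (R : realType) (x : R) (k : nat) : int :=
  Num.floor (complete_quotient x k).

(* Numerators and denominators of the convergents of [a 0; a 1, a 2, ...]. *)
Fixpoint cf_num (a : nat -> int) (k : nat) : int :=
  if k is j.+1 then
    if j is i.+1 then a k * cf_num a j + cf_num a i else a 1%N * a 0%N + 1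
  else a 0%N.

Fixpoint cf_den (a : nat -> int) (k : nat) : int :=
  if k is j.+1 then
    if j is i.+1 then a k * cf_den a j + cf_den a i else a 1%N
  else 1.

Lemma complete_quotient_irrational (R : realType) (x : R) (k : nat) :
  irrational x -> irrational (complete_quotient x k).
Proof.
move=> xirr; elim: k => [//|k IH] /= [r _ /= rE]; apply: IH.
exists (r^-1 + (partial_quotient x k)%:~R) => //=.
by rewrite rmorphD fmorphV rmorph_int /= rE invrK subrK.
Qed.

Lemma fractional_part_gt0 (R : realType) (x : R) (k : nat) :
  irrational x -> 0 < complete_quotient x k - (partial_quotient x k)%:~R.
Proof.
move=> xirr; rewrite lt_neqAle subr_ge0 real_floor_le ?num_real// andbT.
rewrite eq_sym subr_eq0; apply/eqP => yE.
apply: (complete_quotient_irrational (k := k) xirr).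
by exists (partial_quotient x k)%:~R => //=; rewrite ratr_int yE.
Qed.

Lemma complete_quotient_gt1 (R : realType) (x : R) (k : nat) :
  irrational x -> 1 < complete_quotient x k.+1.
Proof.
move=> xirr /=; rewrite invf_gt1 ?(fractional_part_gt0 k xirr)//.
have := real_floorD1_gt (num_real (complete_quotient x k)).
by rewrite rmorphD /= ltrBlDl.
Qed.

Lemma partial_quotient_gt0 (R : realType) (x : R) (k : nat) :
  irrational x -> 0 < partial_quotient x k.+1.
Proof.
move=> xirr; rewrite /partial_quotient gtz0_ge1.
by rewrite real_floor_ge_int ?num_real// ltW// complete_quotient_gt1.
Qed.

Lemma cf_den_ge (a : nat -> int) (k : nat) :
  (forall j, 0 < a j.+1) -> (k%:Z <= cf_den a k) /\ (0 < cf_den a k).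
Proof.
move=> a0.
suff H : forall n, [/\ (n%:Z <= cf_den a n), 0 < cf_den a n,
    (n.+1%:Z <= cf_den a n.+1) & 0 < cf_den a n.+1] by have [] := H k.
elim=> [|n [H1 H2 H3 H4]]; first by split=> //=; have := a0 0%N; lia.
have := a0 n.+1; split=> //=; rewrite -/(cf_den a n.+1); nia.
Qed.

Lemma convergent_error (R : realType) (x : R) (k : nat) : irrational x ->
  `|(cf_den (partial_quotient x) k)%:~R * x
    - (cf_num (partial_quotient x) k)%:~R| < 1.
Proof.
set a := partial_quotient x; set y := complete_quotient x => xirr.
pose d k : R := (cf_den a k)%:~R * x - (cf_num a k)%:~R.
have yE n : y n = (a n)%:~R + (y n.+1)^-1 by rewrite /y /= invrK addrC subrK.
have y1 n : 1 < y n.+1 by exact: complete_quotient_gt1.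
have yN0 n : y n.+1 != 0 by rewrite gt_eqF// (lt_trans ltr01).
have dE n : d n.+1 * y n.+2 = - d n.
  elim: n => [|n IH].
    rewrite /d /= !rmorphD /= !rmorphM /= mul1r -[x]/(y 0%N) (yE 0%N).
    have := yE 1%N; have := yN0 0%N; have := yN0 1%N.
    move: (y 1%N) (y 2%N) (a 1%N) (a 0%N) => y1' y2 a1 a0 y2N0 y1N0 E.
    have -> : a1%:~R = y1' - y2^-1 :> R by rewrite E addrK.
    by field; rewrite y1N0 y2N0.
  have -> : d n.+2 = (a n.+2)%:~R * d n.+1 + d n.
    rewrite /d /= -/(cf_den a n.+1) -/(cf_num a n.+1) !rmorphD /= !rmorphM /=.
    by ring.
  have -> : d n = - (d n.+1 * y n.+2) by rewrite IH opprK.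
  have -> : (a n.+2)%:~R = y n.+2 - (y n.+3)^-1 by rewrite (yE n.+2) addrK.
  by field; rewrite yN0.
rewrite -/(d k); elim: k => [|k IH].
  rewrite /d /= mul1r ger0_norm ?subr_ge0 ?real_floor_le ?num_real//.
  have := real_floorD1_gt (num_real x).
  by rewrite rmorphD /= ltrBlDl.
have -> : d k.+1 = - d k / y k.+2 by rewrite -dE mulfK.
rewrite normrM normrN normfV (gtr0_norm (lt_trans ltr01 (y1 k.+1))).
by rewrite ltr_pdivrMr ?(lt_trans ltr01)// mul1r (lt_trans IH).
Qed.

Lemma cvg_convergents (R : realType) (x : R) : irrational x ->
  (cf_num (partial_quotient x) k)%:~R / (cf_den (partial_quotient x) k)%:~R
    @[k --> \oo] --> x.
Proof.
set a := partial_quotient x => xirr.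
have B n : x - harmonic n
    <= (cf_num a n.+1)%:~R / (cf_den a n.+1)%:~R <= x + harmonic n.
  have [qn q0] := cf_den_ge n.+1 (fun j => partial_quotient_gt0 j xirr).
  have q0R : 0 < (cf_den a n.+1)%:~R :> R by rewrite ltr0z.
  rewrite -ler_distlC -[X in X - _](mulfK (lt0r_neq0 q0R)) -mulrBl.
  rewrite normrM normfV (gtr0_norm q0R) ler_pdivrMr// [x * _]mulrC.
  apply/ltW/(lt_le_trans (convergent_error n.+1 xirr)).
  by rewrite mulrC ler_pdivlMr ?ltr0n// mul1r -[n.+1%:R]/(n.+1%:Z%:~R) ler_int.
have {}B : \forall n \near \oo, x - harmonic n
    <= (cf_num a n.+1)%:~R / (cf_den a n.+1)%:~R <= x + harmonic n.
  exact: nearW.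
rewrite -cvg_shiftS; apply: (squeeze_cvgr B).
- rewrite -[X in _ --> X]subr0.
  by apply: cvgB; [exact: cvg_cst|exact: cvg_harmonic].
- rewrite -[X in _ --> X]addr0.
  by apply: cvgD; [exact: cvg_cst|exact: cvg_harmonic].
Qed.

Lemma irrational_invr_pi (R : realType) : irrational (pi^-1 : R).
Proof.
move=> [r _ /= rE]; apply: (@pi_irrationnal R).
by exists r^-1 => //=; rewrite fmorphV /= rE invrK.
Qed.

(* Main.v *)
Require Import Defs.
From HB Require Import structures.
From mathcomp Require Import all_boot all_order all_algebra.
From mathcomp Require Import archimedean.
From mathcomp Require Import boolp classical_sets functions reals ereal topology.
From mathcomp Require Import normedtype sequences trigo.
From mathcomp Require Import derive.
From mathcomp Require Import zify ring lra.

Import Order.TTheory GRing.Theory Num.Theory.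
Import numFieldNormedType.Exports.

Local Open Scope classical_set_scope.
Local Open Scope ring_scope.

(** Let q be the denominators of the convergents of x = 1/pi, and write ||y||
    for the distance from y to the nearest integer. Since n = pi * (n * x), the
    number sin(n)^2 is comparable to ||n x||^2 ([sin_sqr_le], [sin_sqr_ge]), so
    the series to study is the sum of 1 / (n^3 ||n x||^2).

    If the series converges, look only at its terms with n = q_k. There
    ||q_k x|| <= 1 / q_(k+1), so the term is at least a constant times
    q_(k+1)^2 / q_k^3 >= a_(k+1)^2 / q_k ([cf_term_le_flint_term]).

    Conversely, cut the series into the blocks q_k <= n < q_(k+1), and each
    block into windows of q_k consecutive integers. The law of best
    approximation ([best_approximation]) is used twice. For differences of
    indices, which are smaller than q_k inside a window, it says that the signed
    distances n x - r_n to the nearest integers r_n are 1 / (2 q_k)-separated;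
    for the indices themselves, which are smaller than q_(k+1), it says that
    these distances are at least 1 / (2 q_(k+1)). A separated family
    contributes like an inverse-square series to the sum of the inverse squares,
    except for the at most two members closest to 0
    ([sum_inv_sqr_separated_signed]), so a window contributes at most
    24 q_(k+1)^2 to the sum of 1 / ||n x||^2. In the j-th window n >= j q_k,
    and summing over j the factor 1 / (j q_k)^3 bounds the whole block by a
    constant times q_(k+1)^2 / q_k^3 ([sum_block_le]). As
    q_(k+1) <= 2 a_(k+1) q_k, this is a constant times a_(k+1)^2 / q_k.

    Both series have nonnegative terms, so their convergence amounts to the
    boundedness of their partial sums, and the two comparisons above conclude. *)

(** * Best approximation by convergents *)

(** The errors q_k x - p_k alternate in sign; the factor (-1)^k makes them
    positive, so that this is |q_k x - p_k| with no absolute value to handle. *)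
Definition convergent_gap {R : realType} (x : R) (k : nat) : R :=
  (-1) ^+ k * ((cf_den (partial_quotient x) k)%:~R * x
               - (cf_num (partial_quotient x) k)%:~R).

Lemma convergent_gap_rec {R : realType} (x : R) k :
  convergent_gap x k.+2 =
  convergent_gap x k - (partial_quotient x k.+2)%:~R * convergent_gap x k.+1.
Proof.
rewrite /convergent_gap /= -/(cf_den _ k.+1) -/(cf_num _ k.+1).
by rewrite !rmorphD !rmorphM /= !exprS; ring.
Qed.

Lemma complete_quotientE {R : realType} (x : R) k :
  complete_quotient x k
  = (partial_quotient x k)%:~R + (complete_quotient x k.+1)^-1.
Proof. by rewrite /= invrK addrC subrK. Qed.

Lemma complete_quotient_neq0 {R : realType} (x : R) k :
  irrational x -> complete_quotient x k.+1 != 0.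
Proof. by move=> /complete_quotient_gt1 H; rewrite gt_eqF// (lt_trans ltr01). Qed.

(** Successive errors shrink by the factor given by the complete quotient. As
    that quotient exceeds 1, positivity and monotonicity of the gap follow. *)
Lemma convergent_gap_quotient {R : realType} (x : R) k : irrational x ->
  convergent_gap x k = complete_quotient x k.+2 * convergent_gap x k.+1.
Proof.
move=> xirr; elim: k => [|k IH].
  have E0 : x = (partial_quotient x 0)%:~R + (complete_quotient x 1)^-1.
    exact: (complete_quotientE x 0).
  have E1 := complete_quotientE x 1.
  have N1 := complete_quotient_neq0 x 0 xirr.
  have N2 := complete_quotient_neq0 x 1 xirr.
  move: E0 E1 N1 N2.
  move: (complete_quotient x 1) (complete_quotient x 2) => y1 y2.
  rewrite /convergent_gap expr0 expr1 /= rmorphD !rmorphM /=.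
  move: (partial_quotient x 0) (partial_quotient x 1) => a0 a1 E0 E1 N1 N2.
  have -> : a1%:~R = y1 - y2^-1 by rewrite E1 addrK.
  rewrite E0.
  by field; rewrite N1 N2.
rewrite (convergent_gap_rec x k) IH.
have := complete_quotientE x k.+2.
have := complete_quotient_neq0 x k.+2 xirr.
move: (complete_quotient x k.+2) (complete_quotient x k.+3) => y2 y3 N3 E2.
by rewrite E2; field.
Qed.

Lemma convergent_gap_gt0 {R : realType} (x : R) k :
  irrational x -> 0 < convergent_gap x k.
Proof.
move=> xirr; elim: k => [|k].
  by rewrite /convergent_gap expr0 /= !mul1r; exact: (fractional_part_gt0 0 xirr).
rewrite convergent_gap_quotient// pmulr_rgt0//.
exact: lt_trans ltr01 (complete_quotient_gt1 _ xirr).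
Qed.

Lemma convergent_gap_lt {R : realType} (x : R) k :
  irrational x -> convergent_gap x k.+1 < convergent_gap x k.
Proof.
move=> xirr; rewrite (convergent_gap_quotient x k)//.
rewrite -[ltLHS]mul1r ltr_pM2r ?convergent_gap_gt0//.
exact: complete_quotient_gt1.
Qed.

(** The left-hand side does not depend on k, by the three-term recurrences of
    the denominators and of the gap. As its two terms are nonnegative and both
    sequences are monotone, it yields the two bounds
    1 / (2 q_(k+1)) <= |q_k x - p_k| <= 1 / q_(k+1). *)
Lemma convergent_gap_den {R : realType} (x : R) k :
  (cf_den (partial_quotient x) k.+1)%:~R * convergent_gap x k
  + (cf_den (partial_quotient x) k)%:~R * convergent_gap x k.+1 = 1.
Proof.
elim: k => [|k IH].
  by rewrite /convergent_gap expr0 expr1 /= rmorphD rmorphM /=; ring.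
rewrite -[RHS]IH convergent_gap_rec /= -/(cf_den _ k.+1) rmorphD rmorphM /=.
by ring.
Qed.

Lemma cf_den_gt0 {R : realType} (x : R) k :
  irrational x -> 0 < cf_den (partial_quotient x) k.
Proof.
move=> xirr.
by have [] := cf_den_ge k (fun j => partial_quotient_gt0 j xirr).
Qed.

Lemma cf_den_le {R : realType} (x : R) k : irrational x ->
  cf_den (partial_quotient x) k <= cf_den (partial_quotient x) k.+1.
Proof.
move=> xirr; case: k => [|k] /=.
  by have := partial_quotient_gt0 0 xirr; lia.
rewrite -/(cf_den _ k.+1).
have := partial_quotient_gt0 k.+1 xirr; have := cf_den_gt0 x k.+1 xirr.
by have := cf_den_gt0 x k xirr; nia.
Qed.

Lemma cf_den_lt {R : realType} (x : R) k : irrational x ->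
  cf_den (partial_quotient x) k.+1 < cf_den (partial_quotient x) k.+2.
Proof.
move=> xirr /=; rewrite -/(cf_den _ k.+1).
have := partial_quotient_gt0 k.+1 xirr; have := cf_den_gt0 x k.+1 xirr.
by have := cf_den_gt0 x k xirr; nia.
Qed.

Lemma convergent_gap_le_inv {R : realType} (x : R) k : irrational x ->
  convergent_gap x k <= ((cf_den (partial_quotient x) k.+1)%:~R)^-1.
Proof.
move=> xirr; rewrite -[leRHS]mul1r ler_pdivlMr ?ltr0z ?cf_den_gt0//.
rewrite -[leRHS](convergent_gap_den x k) mulrC lerDl.
by rewrite mulr_ge0 ?ler0z// ltW// ?cf_den_gt0 ?convergent_gap_gt0.
Qed.

Lemma convergent_gap_ge_inv {R : realType} (x : R) k : irrational x ->
  (2 * (cf_den (partial_quotient x) k.+1)%:~R)^-1 <= convergent_gap x k.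
Proof.
move=> xirr.
have q1 : 0 < (cf_den (partial_quotient x) k.+1)%:~R :> R.
  by rewrite ltr0z cf_den_gt0.
have q0 : 0 < (cf_den (partial_quotient x) k)%:~R :> R.
  by rewrite ltr0z cf_den_gt0.
rewrite -[leLHS]mul1r ler_pdivrMr ?mulr_gt0//.
have qle : (cf_den (partial_quotient x) k)%:~R
    <= (cf_den (partial_quotient x) k.+1)%:~R :> R by rewrite ler_int cf_den_le.
have := convergent_gap_den x k; have := convergent_gap_lt x k xirr.
have := convergent_gap_gt0 x k.+1 xirr.
move: (convergent_gap x k) (convergent_gap x k.+1) q1 q0 qle.
by move: (cf_den _ k)%:~R (cf_den _ k.+1)%:~R => u v g h; nra.
Qed.

(** The vectors (q_k, p_k) and (q_(k+1), p_(k+1)) form a basis of the lattice of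
    integer pairs: this determinant is what makes coordinates integral. *)
Lemma cf_det (a : nat -> int) k :
  cf_num a k.+1 * cf_den a k - cf_num a k * cf_den a k.+1 = (-1) ^+ k.
Proof.
elim: k => [|k IH]; first by rewrite /=; ring.
rewrite exprS -IH /= -/(cf_den a k.+1) -/(cf_num a k.+1); ring.
Qed.

(** Law of best approximation. Write (m, p) in the basis of two consecutive
    convergents with integer coordinates u (for k+1) and v (for k). Since
    0 < m < q_(k+1), v is nonzero and u, v do not have the same sign; as the
    errors of the two convergents have opposite signs, the two contributions to
    m x - p add up instead of cancelling, and that of v alone is at least the
    k-th gap. *)
Lemma best_approximation {R : realType} (x : R) k (m p : int) :
  irrational x -> 0 < m < cf_den (partial_quotient x) k.+1 ->
  convergent_gap x k <= `|m%:~R * x - p%:~R|.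
Proof.
move=> xirr /andP[m0 mq].
set a := partial_quotient x in mq *.
(* Cramer's rule, the determinant being (-1)^k. *)
pose v := (-1) ^+ k * (m * cf_num a k.+1 - p * cf_den a k.+1).
pose u := - ((-1) ^+ k * (m * cf_num a k - p * cf_den a k)).
have sgn2 := sqrr_sign int k; rewrite expr2 in sgn2.
have mE : m = u * cf_den a k.+1 + v * cf_den a k.
  rewrite -[LHS]mulr1 -sgn2 -{2}(cf_det a k) /u /v; ring.
have pE : p = u * cf_num a k.+1 + v * cf_num a k.
  rewrite -[LHS]mulr1 -sgn2 -{2}(cf_det a k) /u /v; ring.
clearbody u v.
have -> : `|m%:~R * x - p%:~R| =
    `|v%:~R * convergent_gap x k - u%:~R * convergent_gap x k.+1|.
  transitivity `|(-1) ^+ k * (m%:~R * x - p%:~R)|.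
    by rewrite normrM normrX normrN1 expr1n mul1r.
  congr `|_|; rewrite mE pE !rmorphD !rmorphM /= /convergent_gap exprS -/a.
  by move: u%:~R v%:~R => u' v'; ring.
have q0 : 0 < cf_den a k by exact: cf_den_gt0.
have q1 : 0 < cf_den a k.+1 by exact: cf_den_gt0.
have g0 := convergent_gap_gt0 x k xirr.
have g1 := convergent_gap_gt0 x k.+1 xirr.
move: (cf_den a k) (cf_den a k.+1) q0 q1 mE mq => q q' q0 q1 mE mq.
rewrite ler_normr; apply/orP.
have [v0|v0|v0] := ltgtP v 0.
- right; have u0 : 1 <= u by nia.
  have : v%:~R <= (-1)%:~R :> R by rewrite ler_int; lia.
  have : 1%:~R <= u%:~R :> R by rewrite ler_int.
  rewrite mulrN1z; nra.
- left; have u0 : u <= 0 by nia.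
  have : 1%:~R <= v%:~R :> R by rewrite ler_int; lia.
  have : u%:~R <= 0%:~R :> R by rewrite ler_int.
  nra.
- exfalso; move: mE; rewrite v0 mul0r addr0 => mE.
  by have [u0|u0] := lerP u 0; nia.
Qed.

(** * The sine at integers and the distance to multiples of pi *)

Lemma sin_le_self {R : realType} (t : R) : 0 <= t -> sin t <= t.
Proof.
move=> t0.
have [c _] := MVT_segment t0 (fun x _ => is_derive_sin x)
  (continuous_subspaceT (@continuous_sin R)).
by rewrite sin0 !subr0 => ->; rewrite ler_piMl ?cos_le1.
Qed.

(** A weak form of Jordan's inequality. The mean value theorem at t/2 gives
    sin (t/2) >= (t/2) cos (t/2), hence
    sin t = 2 sin (t/2) cos (t/2) >= t cos^2 (t/2) = t (1 + cos t) / 2. *)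
Lemma sin_ge_half {R : realType} (t : R) : 0 <= t <= pi / 2 -> t / 2 <= sin t.
Proof.
move=> /andP[t0 tpi].
have h0 : 0 <= t / 2 by lra.
have pi0 : 0 < pi :> R by exact: pi_gt0.
have [c] := MVT_segment h0 (fun x _ => is_derive_sin x)
  (continuous_subspaceT (@continuous_sin R)).
rewrite in_itv /= sin0 !subr0 => /andP[c0 ct] sE.
have cc : cos (t / 2) <= cos c.
  by rewrite leNgt ltr_cos ?in_itv/= -?leNgt//; apply/andP; split; lra.
have cos_t : 0 <= cos t by apply: cos_ge0_pihalf; apply/andP; split; lra.
have tE : t = (t / 2) *+ 2 by rewrite -mulr_natr; lra.
have ch : 0 <= cos (t / 2) by apply: cos_ge0_pihalf; apply/andP; split; lra.
rewrite [in X in _ <= X]tE sin_mulr2n sE.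
move: cos_t; rewrite {1}tE cos_mulr2n.
move: (cos (t / 2)) (cos c) cc ch => u v uv u0 cos_t.
have uv2 : u * u <= u * v by rewrite ler_wpM2l.
have half : 1 / 2 <= u * v by lra.
by have := ler_wpM2l t0 half; lra.
Qed.

Lemma sin_sqr_subMpi {R : realType} (t : R) (m : int) :
  sin (t - m%:~R * pi) ^+ 2 = sin t ^+ 2.
Proof.
have addn (u : R) (n : nat) : sin (u + n%:R * pi) ^+ 2 = sin u ^+ 2.
  elim: n => [|n IH]; first by rewrite mul0r addr0.
  by rewrite mulrSr mulrDl mul1r addrA sinDpi sqrrN.
case: m => n; first by rewrite -(addn (t - _) n) subrK.
by rewrite NegzE rmorphN /= mulNr opprK addn.
Qed.

Lemma sin_sqr_distE {R : realType} (n : nat) (m : int) :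
  sin n%:R ^+ 2 = sin (pi * `|n%:R * pi^-1 - m%:~R|) ^+ 2 :> R.
Proof.
have piN0 : pi != 0 :> R by rewrite gt_eqF ?pi_gt0.
rewrite -(sin_sqr_subMpi n%:R m).
have -> : n%:R - m%:~R * pi = pi * (n%:R * pi^-1 - m%:~R) :> R.
  by rewrite mulrBr mulrCA mulfV// mulr1 [pi * _]mulrC.
have [_|_] := ger0P (n%:R * pi^-1 - m%:~R : R); first by [].
by rewrite mulrN sinN sqrrN.
Qed.

(** With [sin_sqr_ge], the comparison of |sin n| with |n / pi - m| for an integer
    m close to n / pi. The tolerance 1 is what the gap of a convergent satisfies
    without a case distinction on the size of its denominator. *)
Lemma sin_sqr_le {R : realType} (n : nat) (m : int) :
  `|n%:R * pi^-1 - m%:~R| <= 1 :> R ->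
  sin n%:R ^+ 2 <= (pi * (n%:R * pi^-1 - m%:~R)) ^+ 2 :> R.
Proof.
move=> d1; rewrite (sin_sqr_distE n m) -[leRHS]real_normK ?num_real// normrM.
rewrite (ger0_norm (pi_ge0 R)).
have := normr_ge0 (n%:R * pi^-1 - m%:~R : R); move: d1.
move: `|_| => d d1 dge0; have d0 : 0 <= pi * d by rewrite mulr_ge0 ?pi_ge0.
rewrite ler_sqr ?nnegrE ?sin_le_self//.
by apply: sin_ge0_pi; rewrite d0 ler_piMr ?pi_ge0.
Qed.

Lemma sin_sqr_ge {R : realType} (n : nat) (m : int) :
  `|n%:R * pi^-1 - m%:~R| <= 1 / 2 :> R ->
  (n%:R * pi^-1 - m%:~R) ^+ 2 <= sin n%:R ^+ 2 :> R.
Proof.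
move=> d1; rewrite (sin_sqr_distE n m) -[leLHS]real_normK ?num_real//.
have := normr_ge0 (n%:R * pi^-1 - m%:~R : R); move: d1.
move: `|_| => d d1 d0.
have p2 : 2 <= pi :> R by exact: pi_ge2.
have sd : pi * d / 2 <= sin (pi * d).
  by apply: sin_ge_half; apply/andP; split; nra.
have dd : d <= pi * d / 2 by nra.
by rewrite ler_sqr ?nnegrE ?(le_trans d0)// (le_trans dd).
Qed.

(** * Sums of inverse squares over separated families *)

(** The index 0 contributes 0^-1 = 0. The bound 2 - 1/n on the partial sum up to
    n telescopes. *)
Lemma sum_inv_sqr_le2 {R : realType} (M : nat) :
  \sum_(0 <= j < M) (j%:R ^+ 2)^-1 <= 2 :> R.
Proof.
suff H n : \sum_(0 <= j < n.+1) (j%:R ^+ 2)^-1 <= 2 - n%:R^-1 :> R.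
  case: M => [|n]; first by rewrite big_nil.
  by apply: le_trans (H n) _; rewrite gerBl invr_ge0.
elim: n => [|[|n] IH].
- by rewrite big_nat1 expr0n !invr0 subr0.
- by rewrite big_nat_recr//= big_nat1 expr0n expr1n invr0 invr1; lra.
rewrite big_nat_recr//= -[n.+2%:R]natr1; move: IH.
have : 0 < n.+1%:R :> R by rewrite ltr0n.
move: (\sum_(_ <= _ < _) _) n.+1%:R => S u u0 IH.
suff : ((u + 1) ^+ 2)^-1 <= u^-1 - (u + 1)^-1 by lra.
have -> : u^-1 - (u + 1)^-1 = (u * (u + 1))^-1.
  by field; apply/andP; split; rewrite gt_eqF//; lra.
by rewrite lef_pV2 ?posrE; nra.
Qed.

(** Sort the values into the cells [j d, (j+1) d): separation puts at most one of
    them in each cell. The one in the cell j > 0 is at least j d, and the one in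
    the cell 0 is at least e, so the sum is bounded by one inverse-square series
    plus an exceptional term. *)
Lemma sum_inv_sqr_separated_pos {R : realType} (s : seq nat) (x : nat -> R)
    (e d : R) :
  uniq s -> 0 < e -> 0 < d ->
  (forall n, n \in s -> e <= x n) ->
  (forall m n, m \in s -> n \in s -> m != n -> d <= `|x m - x n|) ->
  \sum_(n <- s) (x n ^+ 2)^-1 <= (e ^+ 2)^-1 + 2 * (d ^+ 2)^-1.
Proof.
move=> us e0 d0 xe xsep.
pose t n := Num.truncn (x n / d).
(* The bound attached to the cell j; its second summand vanishes at j = 0
   because 0^-1 = 0. *)
pose G (j : nat) : R := (j == 0)%:R * (e ^+ 2)^-1 + (d ^+ 2)^-1 * (j%:R ^+ 2)^-1.
have G0 j : 0 <= G j.
  by rewrite addr_ge0 ?mulr_ge0 ?invr_ge0 ?exprn_ge0 ?(ltW e0) ?(ltW d0)// ler0n.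
have x0 n : n \in s -> 0 < x n by move=> /xe; exact: lt_le_trans.
have tb n : n \in s -> (t n)%:R * d <= x n < (t n).+1%:R * d.
  move=> ns; rewrite -ler_pdivlMr// -ltr_pdivrMr//.
  by apply: truncn_itv; rewrite divr_ge0 ?ltW ?x0.
have tinj : {in s &, injective t}.
  move=> m n ms ns tmn; apply/eqP; apply/negPn/negP => mn.
  have := xsep _ _ ms ns mn; apply/negP; rewrite -ltNge ltr_norml.
  have := tb _ ms; have := tb _ ns; rewrite tmn -natr1 mulrDl mul1r.
  by move=> /andP[? ?] /andP[? ?]; apply/andP; split; lra.
have xG n : n \in s -> (x n ^+ 2)^-1 <= G (t n).
  move=> ns; rewrite /G; have [t0|t0] := eqVneq (t n) 0%N.
    rewrite t0 expr0n invr0 mulr0 addr0 mul1r.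
    rewrite lef_pV2 ?posrE ?exprn_gt0 ?x0//.
    by rewrite ler_sqr ?nnegrE ?xe// ltW ?x0.
  rewrite mul0r add0r -invfM -exprMn mulrC.
  have /andP[tx _] := tb _ ns.
  have td : 0 < (t n)%:R * d by rewrite mulr_gt0// ltr0n lt0n.
  rewrite lef_pV2 ?posrE ?exprn_gt0 ?x0//.
  by rewrite ler_sqr ?nnegrE ?(ltW td) ?(ltW (x0 _ ns)).
apply: (@le_trans _ _ (\sum_(n <- s) G (t n))).
  by rewrite big_seq [leRHS]big_seq; apply: ler_sum => n /xG.
rewrite -(big_map t predT G) /=.
set s' := map t s.
have us' : uniq s' by rewrite map_inj_in_uniq.
pose M := (\max_(j <- s') j).+1.
have -> : \sum_(j <- s') G j = \sum_(0 <= j < M | j \in s') G j.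
  rewrite -[RHS]big_filter; apply: perm_big; apply: uniq_perm => //.
    by rewrite filter_uniq// iota_uniq.
  move=> j; rewrite mem_filter mem_index_iota /=.
  case: (boolP (j \in s')) => //= js; rewrite ltnS; symmetry.
  exact: leq_bigmax_seq.
apply: (@le_trans _ _ (\sum_(0 <= j < M) G j)).
  by rewrite [leLHS]big_mkcond; apply: ler_sum => j _; case: ifP.
rewrite big_split /= lerD//.
  rewrite -mulr_suml ler_piMl ?invr_ge0 ?exprn_ge0 ?(ltW e0)//.
  rewrite big_nat_recl// eqxx big1 ?addr0// => j _; by [].
by rewrite -mulr_sumr mulrC ler_wpM2r ?invr_ge0 ?exprn_ge0 ?(ltW d0)// sum_inv_sqr_le2.
Qed.

(** The positive and the negative values are separated families, whence the
    factor 2. *)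
Lemma sum_inv_sqr_separated_signed {R : realType} (s : seq nat) (x : nat -> R)
    (e d : R) :
  uniq s -> 0 < e -> 0 < d ->
  (forall n, n \in s -> e <= `|x n|) ->
  (forall m n, m \in s -> n \in s -> m != n -> d <= `|x m - x n|) ->
  \sum_(n <- s) (x n ^+ 2)^-1 <= 2 * ((e ^+ 2)^-1 + 2 * (d ^+ 2)^-1).
Proof.
move=> us e0 d0 xe xsep.
rewrite (bigID (fun n => 0 < x n)) /= mulr_natl mulr2n lerD//.
  rewrite -big_filter; apply: sum_inv_sqr_separated_pos => //.
  - by rewrite filter_uniq.
  - move=> n; rewrite mem_filter => /andP[xn0 ns].
    by have := xe n ns; rewrite gtr0_norm.
  - move=> m n; rewrite !mem_filter => /andP[_ ms] /andP[_ ns]; exact: xsep.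
rewrite -big_filter.
under eq_bigr do rewrite -sqrrN.
apply: sum_inv_sqr_separated_pos => //.
- by rewrite filter_uniq.
- move=> n; rewrite mem_filter -leNgt => /andP[xn0 ns].
  by have := xe n ns; rewrite ler0_norm.
- move=> m n; rewrite !mem_filter => /andP[_ ms] /andP[_ ns] mn.
  by rewrite -opprD normrN; exact: xsep.
Qed.

(** * Sums over the blocks between two denominators *)

(** The form in which best approximation enters the summation: multiples m x with
    0 < m < q stay at distance at least 1 / (2 q) from the integers. Every
    denominator of a convergent has this property ([cf_den_repels]). *)
Definition repels_below {R : realType} (x : R) (q : nat) : Prop :=
  forall m p : int, 0 < m < q%:Z -> (2 * q%:R)^-1 <= `|m%:~R * x - p%:~R|.

(** The difference of two such values is itself (m - n) x minus an integer. *)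
Lemma repels_below_dist {R : realType} (x : R) (q : nat) (r : nat -> int) m n :
  repels_below x q -> m != n -> (`|m%:Z - n%:Z| < q)%N ->
  (2 * q%:R)^-1 <= `|(m%:R * x - (r m)%:~R) - (n%:R * x - (r n)%:~R)|.
Proof.
move=> rq; wlog mn : m n / (n < m)%N => [H mn mnq|_ mnq].
  have [nm|nm] := ltnP n m; first exact: H.
  by rewrite distrC; apply: H; [lia|rewrite eq_sym|lia].
have -> : (m%:R * x - (r m)%:~R) - (n%:R * x - (r n)%:~R) =
    (m%:Z - n%:Z)%:~R * x - (r m - r n)%:~R by rewrite !rmorphB /=; ring.
by apply: rq; lia.
Qed.

(** On the j-th window the factor 1 / n^3 is at most 1 / (j q)^3, and what remains
    is a separated family with d = 1 / (2 q) and e = 1 / (2 q'). The exponent of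
    j is lowered to 2, which is enough for summability in j; moreover 0^-1 = 0
    makes the bound vanish for j = 0, as it must: that window has no n >= q. *)
Lemma sum_window_le {R : realType} (x : R) (r : nat -> int) (q q' j : nat) :
  (0 < q)%N -> (q <= q')%N -> repels_below x q -> repels_below x q' ->
  \sum_(j * q <= n < j.+1 * q | (q <= n < q')%N)
     (n%:R ^+ 3 * (n%:R * x - (r n)%:~R) ^+ 2)^-1
  <= 24 * (q'%:R ^+ 2 / q%:R ^+ 3) * (j%:R ^+ 2)^-1 :> R.
Proof.
move=> q0 qq' rq rq'.
case: j => [|j].
  rewrite big_nat_cond big_pred0 => [|n]; last by apply/negP => /andP[]; lia.
  by rewrite expr0n invr0 mulr0.
set s := [seq n <- index_iota (j.+1 * q) (j.+2 * q) | (q <= n < q')%N].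
have qR : 0 < q%:R :> R by rewrite ltr0n.
have q'R : 0 < q'%:R :> R by rewrite ltr0n (leq_trans q0).
have jR : 0 < j.+1%:R :> R by rewrite ltr0n.
have qq'R : q%:R <= q'%:R :> R by rewrite ler_nat.
have S : \sum_(n <- s) ((n%:R * x - (r n)%:~R) ^+ 2)^-1 <= 24 * q'%:R ^+ 2 :> R.
  have := sum_inv_sqr_separated_signed s (fun n => n%:R * x - (r n)%:~R)
    (2 * q'%:R)^-1 (2 * q%:R)^-1.
  rewrite !exprVn !invrK => H.
  apply: le_trans (H _ _ _ _ _) _.
  - by rewrite filter_uniq// iota_uniq.
  - by rewrite invr_gt0 mulr_gt0.
  - by rewrite invr_gt0 mulr_gt0.
  - move=> n; rewrite mem_filter => /andP[/andP[qn nq'] _].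
    by apply: (rq' n%:Z (r n)); lia.
  - move=> m n; rewrite !mem_filter !mem_index_iota => /andP[_ Hm] /andP[_ Hn] mn.
    by apply: repels_below_dist => //; nia.
  (* 2 * (4 q'^2 + 2 * 4 q^2) <= 24 q'^2 since q <= q'. *)
  - by rewrite !exprMn; nra.
rewrite -big_filter -/s.
apply: (@le_trans _ _ (\sum_(n <- s) ((j.+1%:R * q%:R) ^+ 3)^-1
    * ((n%:R * x - (r n)%:~R) ^+ 2)^-1)).
  rewrite big_seq [leRHS]big_seq; apply: ler_sum => n.
  rewrite mem_filter mem_index_iota => /andP[_ /andP[jn _]].
  rewrite invfM ler_wpM2r ?invr_ge0 ?sqr_ge0//.
  have jnR : j.+1%:R * q%:R <= n%:R :> R by rewrite -natrM ler_nat.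
  have jq : 0 < j.+1%:R * q%:R :> R by rewrite mulr_gt0.
  rewrite lef_pV2 ?posrE ?exprn_gt0// ?(lt_le_trans jq)//.
  by apply: lerXn2r; rewrite ?nnegrE ?(ltW jq)// (le_trans (ltW jq)).
rewrite -mulr_sumr.
apply: (@le_trans _ _ (((j.+1%:R * q%:R) ^+ 3)^-1 * (24 * q'%:R ^+ 2))).
  by rewrite ler_wpM2l// invr_ge0 exprn_ge0// mulr_ge0// ltW.
rewrite exprMn invfM.
have -> : (j.+1%:R ^+ 3)^-1 / q%:R ^+ 3 * (24 * q'%:R ^+ 2) =
  24 * (q'%:R ^+ 2 / q%:R ^+ 3) * (j.+1%:R ^+ 3)^-1 :> R by ring.
apply: ler_wpM2l.
  by rewrite !mulr_ge0// ?invr_ge0 exprn_ge0// ltW.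
rewrite lef_pV2 ?posrE ?exprn_gt0//.
by rewrite ler_weXn2l// ler1n.
Qed.

(** Only the diophantine property of q and q' matters, and r may be any choice of
    integers. The q' windows [j q, (j+1) q) with j < q' cover the block, and
    summing [sum_window_le] over them costs a factor 2. *)
Lemma sum_block_le {R : realType} (x : R) (r : nat -> int) (q q' : nat) :
  (0 < q)%N -> (q <= q')%N -> repels_below x q -> repels_below x q' ->
  \sum_(q <= n < q') (n%:R ^+ 3 * (n%:R * x - (r n)%:~R) ^+ 2)^-1
  <= 48 * (q'%:R ^+ 2 / q%:R ^+ 3) :> R.
Proof.
move=> q0 qq' rq rq'.
set F := fun n => (n%:R ^+ 3 * (n%:R * x - (r n)%:~R) ^+ 2)^-1.
have -> : \sum_(q <= n < q') F n
    = \sum_(0 <= n < q' * q) (if (q <= n < q')%N then F n else 0).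
  rewrite -big_mkcond -!(big_filter _ (fun n => q <= n < q')%N).
  rewrite (eq_bigl (fun n => true && true))// -[LHS]big_filter.
  apply: perm_big; apply: uniq_perm; rewrite ?filter_uniq ?iota_uniq// => n.
  by rewrite !mem_filter !mem_index_iota /=; nia.
rewrite big_nat_mul.
apply: (@le_trans _ _
  (\sum_(0 <= j < q') 24 * (q'%:R ^+ 2 / q%:R ^+ 3) * (j%:R ^+ 2)^-1)).
  by apply: ler_sum => j _; rewrite -big_mkcond; exact: sum_window_le.
rewrite -mulr_sumr.
have C0 : 0 <= q'%:R ^+ 2 / q%:R ^+ 3 :> R.
  by rewrite mulr_ge0// ?invr_ge0 exprn_ge0.
have := @sum_inv_sqr_le2 R q'; nra.
Qed.

(** * Terms at the denominators and blocks between them for 1/pi *)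

Lemma cf_den_repels {R : realType} (x : R) k :
  irrational x -> repels_below x `|cf_den (partial_quotient x) k.+1|%N.
Proof.
move=> xirr m p; have q0 := cf_den_gt0 x k.+1 xirr.
rewrite natr_absz (gtr0_norm q0) gez0_abs ?(ltW q0)// => mq.
apply: le_trans (best_approximation _ _ _ _ xirr mq).
exact: convergent_gap_ge_inv.
Qed.

Lemma exists_nearest_int {R : realType} (y : R) :
  exists m : int, `|y - m%:~R| <= 1 / 2.
Proof.
exists (Num.floor (y + 1 / 2)).
have /andP[] := floor_itv (y + 1 / 2).
by rewrite rmorphD /= ler_norml => ? ?; apply/andP; split; lra.
Qed.

(** If sin n vanished then n / pi would equal its nearest integer, contradicting
    the irrationality of 1/pi. *)
Lemma sin_sqr_natr_gt0 {R : realType} n :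
  (0 < n)%N -> 0 < sin n%:R ^+ 2 :> R.
Proof.
move=> n0; have n0R : n%:R != 0 :> R by rewrite pnatr_eq0 -lt0n.
rewrite lt_neqAle sqr_ge0 andbT eq_sym; apply/negP => /eqP s0.
have [m /sin_sqr_ge] := exists_nearest_int (n%:R * pi^-1 : R).
rewrite s0 => H; have {H} /eqP : (n%:R * pi^-1 - m%:~R) ^+ 2 = 0 :> R.
  by apply/eqP; rewrite eq_le H sqr_ge0.
rewrite sqrf_eq0 subr_eq0 => /eqP H; apply: (@irrational_invr_pi R).
exists (m%:~R / n%:R) => //=; rewrite fmorph_div /= ratr_int ratr_nat -H.
by rewrite mulrC mulKf.
Qed.

Definition flint_term {R : realType} (n : nat) : R :=
  1 / (n%:R ^+ 3 * sin n%:R ^+ 2).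

Definition cf_term {R : realType} (x : R) (k : nat) : R :=
  (partial_quotient x k.+1)%:~R ^+ 2 / (cf_den (partial_quotient x) k)%:~R.

Lemma flint_term_ge0 {R : realType} n : 0 <= flint_term n :> R.
Proof. by rewrite /flint_term divr_ge0// mulr_ge0 ?sqr_ge0// exprn_ge0. Qed.

Lemma cf_term_ge0 {R : realType} (x : R) k : irrational x -> 0 <= cf_term x k.
Proof.
by move=> xirr; rewrite /cf_term divr_ge0 ?sqr_ge0// ler0z ltW// cf_den_gt0.
Qed.

(** From a q_(k+1) <= q_(k+2) <= 2 a q_(k+1) with a = a_(k+2): both comparisons of
    the two series naturally produce q_(k+2)^2 / q_(k+1)^3. *)
Lemma cf_den_ratio {R : realType} (x : R) k (q := cf_den (partial_quotient x)) :
  irrational x ->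
  cf_term x k.+1 <= (q k.+2)%:~R ^+ 2 / (q k.+1)%:~R ^+ 3 <= 4 * cf_term x k.+1.
Proof.
move=> xirr; have q1 := cf_den_gt0 x k.+1 xirr.
have q0 := cf_den_gt0 x k xirr; have qle := cf_den_le x k xirr.
have a1 := partial_quotient_gt0 k.+1 xirr.
have q2E : q k.+2 = partial_quotient x k.+2 * q k.+1 + q k by [].
have q1R : 0 < (q k.+1)%:~R :> R by rewrite ltr0z.
rewrite /cf_term -/q.
have lo : (partial_quotient x k.+2)%:~R * (q k.+1)%:~R <= (q k.+2)%:~R :> R.
  by rewrite -rmorphM ler_int q2E lerDl ltW.
have hi : (q k.+2)%:~R <= 2 * (partial_quotient x k.+2)%:~R * (q k.+1)%:~R :> R.
  rewrite -[2]/(2%:~R) -!rmorphM ler_int q2E.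
  by rewrite /q; move: q1 q0 qle a1; nia.
have a1R : 0 < (partial_quotient x k.+2)%:~R :> R by rewrite ltr0z.
have -> : (partial_quotient x k.+2)%:~R ^+ 2 / (q k.+1)%:~R
    = ((partial_quotient x k.+2)%:~R * (q k.+1)%:~R) ^+ 2 / (q k.+1)%:~R ^+ 3 :> R.
  by field; rewrite gt_eqF.
move: a1R q1R lo hi; move: (q k.+2)%:~R (q k.+1)%:~R (partial_quotient _ _)%:~R.
move=> z y a a0 y0 lo hi.
rewrite mulrA !ler_pM2r ?invr_gt0 ?exprn_gt0//.
by apply/andP; split; nra.
Qed.

(** The constant is 48 from [sum_block_le] times 4 from [cf_den_ratio]. *)
Lemma sum_flint_block_le {R : realType} k
    (q := fun j => `|cf_den (partial_quotient (pi^-1 : R)) j|%N) :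
  \sum_(q k.+1 <= n < q k.+2) flint_term n <= 192 * cf_term pi^-1 k.+1 :> R.
Proof.
have xirr := @irrational_invr_pi R.
have [r rP] := choice (fun n => exists_nearest_int (n%:R * pi^-1 : R)).
have q1 := cf_den_gt0 _ k.+1 xirr; have q2 := cf_den_gt0 _ k.+2 xirr.
have q12 := cf_den_lt _ k xirr.
have q10 : (0 < q k.+1)%N by rewrite absz_gt0 gt_eqF.
have qq : (q k.+1 <= q k.+2)%N by rewrite /q; lia.
have := sum_block_le pi^-1 r (q k.+1) (q k.+2) q10 qq
  (cf_den_repels _ k xirr) (cf_den_repels _ k.+1 xirr).
have /andP[_] := cf_den_ratio _ k xirr.
rewrite -{1}(gtr0_norm q1) -{1}(gtr0_norm q2) -!natr_absz -/(q _) -/(q _).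
move=> hi S; apply: le_trans (_ : _ <= 48 * (4 * cf_term pi^-1 k.+1)) _; last by lra.
apply: le_trans (ler_wpM2l _ hi) => //; apply: le_trans S.
rewrite big_nat [leRHS]big_nat; apply: ler_sum => n /andP[qn nq].
have n0 : (0 < n)%N by exact: leq_trans qn.
have n0R : 0 < n%:R :> R by rewrite ltr0n.
have xs : (n%:R * pi^-1 - (r n)%:~R) ^+ 2 <= sin n%:R ^+ 2 :> R.
  exact: sin_sqr_ge.
have x0 : 0 < (n%:R * pi^-1 - (r n)%:~R) ^+ 2 :> R.
  rewrite exprn_even_gt0//= -normr_gt0.
  apply: lt_le_trans (cf_den_repels _ k.+1 xirr n%:Z (r n) _).
    by rewrite invr_gt0 mulr_gt0// ltr0n -/(q _) (leq_trans q10).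
  by rewrite -/(q _); lia.
have s0 := lt_le_trans x0 xs; have n3 : 0 < n%:R ^+ 3 :> R by rewrite exprn_gt0.
rewrite /flint_term div1r lef_pV2 ?posrE; first by rewrite ler_wpM2l// ltW.
  by rewrite mulr_gt0.
by rewrite mulr_gt0.
Qed.

(** At n = q_(k+1) the sine is at most pi times the gap of the convergent, hence
    at most pi / q_(k+2). *)
Lemma cf_term_le_flint_term {R : realType} k
    (q := fun j => `|cf_den (partial_quotient (pi^-1 : R)) j|%N) :
  cf_term pi^-1 k.+1 <= pi ^+ 2 * flint_term (q k.+1) :> R.
Proof.
have xirr := @irrational_invr_pi R.
have q1 := cf_den_gt0 _ k.+1 xirr; have q2 := cf_den_gt0 _ k.+2 xirr.
have /andP[lo _] := cf_den_ratio _ k xirr.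
apply: le_trans lo _.
have q10 : (0 < q k.+1)%N by rewrite absz_gt0 gt_eqF.
have s0 := @sin_sqr_natr_gt0 R _ q10.
have qE : (q k.+1)%:R = (cf_den (partial_quotient (pi^-1 : R)) k.+1)%:~R :> R.
  by rewrite natr_absz gtr0_norm.
have gE : `|(q k.+1)%:R * pi^-1
    - (cf_num (partial_quotient (pi^-1 : R)) k.+1)%:~R| = convergent_gap pi^-1 k.+1 :> R.
  rewrite -[RHS]gtr0_norm ?convergent_gap_gt0// /convergent_gap normrM normrX.
  by rewrite normrN1 expr1n mul1r qE.
have g0 := convergent_gap_gt0 _ k.+1 xirr.
have gq := convergent_gap_le_inv _ k.+1 xirr.
have q2R : 1 <= (cf_den (partial_quotient (pi^-1 : R)) k.+2)%:~R :> R.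
  by rewrite -[1]/(1%:~R) ler_int.
have := @sin_sqr_le R (q k.+1) (cf_num (partial_quotient (pi^-1 : R)) k.+1).
rewrite gE exprMn -(real_normK (num_real (_ - _))) gE => /(_ _).
move=> /(_ (le_trans gq _)); rewrite invf_le1 ?(lt_le_trans ltr01)// => /(_ q2R).
move: s0; rewrite /flint_term -qE div1r.
have q1R : 0 < (q k.+1)%:R :> R by rewrite ltr0n.
move: (sin _ ^+ 2) (convergent_gap _ _) (cf_den _ _)%:~R q2R g0 gq.
move=> s g z z1 g0 gz s0 sg.
have z0 : 0 < z by exact: lt_le_trans z1.
rewrite [(_ * s)^-1]invfM [leRHS]mulrCA [leLHS]mulrC.
apply: ler_wpM2l; first by rewrite invr_ge0 exprn_ge0.
rewrite ler_pdivlMr//.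
have gz1 : g * z <= 1 by rewrite -ler_pdivlMr// mul1r.
have gz2 : (g * z) ^+ 2 <= 1 by rewrite expr_le1// mulr_ge0 ?ltW.
have pi0 : 0 <= pi ^+ 2 :> R by rewrite sqr_ge0.
apply: (@le_trans _ _ (z ^+ 2 * (pi ^+ 2 * g ^+ 2))).
  by rewrite ler_wpM2l ?sqr_ge0.
have -> : z ^+ 2 * (pi ^+ 2 * g ^+ 2) = pi ^+ 2 * (g * z) ^+ 2 by ring.
by rewrite ler_piMr.
Qed.

(** * Partial sums and convergence *)

Lemma sum_sparse_le {R : realType} (u : nat -> R) (q : nat -> nat) K :
  (forall n, 0 <= u n) -> (forall k, (0 < q k.+1 < q k.+2)%N) ->
  \sum_(1 <= k < K.+1) u (q k) <= \sum_(1 <= n < q K.+1) u n.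
Proof.
move=> u0 qlt; elim: K => [|K IH]; first by rewrite big_geq// sumr_ge0.
have /andP[q0 qK] := qlt K.
rewrite big_nat_recr//= (big_cat_nat q0 (ltnW qK))//=.
by rewrite lerD// big_ltn// lerDl sumr_ge0.
Qed.

Lemma sum_blocks_le {R : realType} (u c : nat -> R) (q : nat -> nat) K :
  (forall k, (0 < q k.+1 < q k.+2)%N) ->
  (forall k, \sum_(q k.+1 <= n < q k.+2) u n <= c k.+1) ->
  \sum_(1 <= n < q K.+1) u n
  <= \sum_(1 <= n < q 1) u n + \sum_(1 <= k < K.+1) c k.
Proof.
move=> qlt uc; elim: K => [|K IH]; first by rewrite (big_geq (leqnn 1)) addr0.
have /andP[q0 qK] := qlt K.
rewrite (big_cat_nat q0 (ltnW qK))//= big_nat_recr//= addrA.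
by rewrite lerD.
Qed.

Lemma nneseries_ltyP {R : realType} (c : nat -> R) (m : nat) :
  (forall k, 0 <= c k) ->
  (\sum_(m <= k <oo) (c k)%:E < +oo)%E <->
  exists B, forall K, \sum_(m <= k < K) c k <= B.
Proof.
move=> c0; split=> [fin|[B cB]].
- exists (fine (\sum_(m <= k <oo) (c k)%:E)%E) => K.
  rewrite -lee_fin fineK; last first.
    by rewrite ge0_fin_numE// nneseries_ge0// => k _ _; rewrite lee_fin.
  by rewrite -sumEFin; apply: nneseries_lim_ge => k _ _; rewrite lee_fin.
- apply: (@le_lt_trans _ _ B%:E); last exact: ltry.
  apply: lime_le; first by apply: is_cvg_nneseries => k _ _; rewrite lee_fin.
  by apply: nearW => K; rewrite sumEFin lee_fin.
Qed.

Lemma cvgn_sum_nonnegP {R : realType} (u : nat -> R) (m : nat) :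
  (forall n, 0 <= u n) ->
  cvgn (fun N => \sum_(m <= n < N) u n) <->
  exists B, forall N, \sum_(m <= n < N) u n <= B.
Proof.
move=> u0.
have nd : nondecreasing_seq (fun N => \sum_(m <= n < N) u n).
  apply/nondecreasing_seqP => N; have [mN|Nm] := leqP m N.
    by rewrite big_nat_recr//= lerDl.
  by rewrite big_geq ?(ltnW Nm)// sumr_ge0.
split=> [cu|[B uB]].
- exists (limn (fun N => \sum_(m <= n < N) u n)).
  exact: nondecreasing_cvgn_le.
- by apply: nondecreasing_is_cvgn => //; exists B => _ [N _ <-].
Qed.

Theorem theorem1 (R : realType) :
  let a : nat -> int := partial_quotient (pi^-1 : R) in
  let q : nat -> int := cf_den a in
  cvgn (fun N : nat =>
    \sum_(1 <= n < N) (1 / (n%:R ^+ 3 * sin n%:R ^+ 2) : R)) <->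
  (\sum_(1 <= k <oo) ((a k.+1)%:~R ^+ 2 / (q k)%:~R : R)%:E < +oo)%E.
Proof.
move=> a q; have xirr := @irrational_invr_pi R.
apply: (iff_trans (cvgn_sum_nonnegP flint_term 1 flint_term_ge0)).
apply: (iff_trans _ (iff_sym (nneseries_ltyP (cf_term pi^-1) 1
  (fun k => cf_term_ge0 _ k xirr)))).
pose Q j := `|q j|%N.
have QE j : (Q j)%:Z = q j by rewrite /Q gez0_abs// ltW// cf_den_gt0.
have Qlt k : (0 < Q k.+1 < Q k.+2)%N.
  by rewrite -!ltz_nat !QE cf_den_gt0// cf_den_lt.
split=> [[B uB]|[B cB]].
- exists (pi ^+ 2 * B) => -[|K].
    rewrite big_geq// mulr_ge0 ?sqr_ge0//.
    by apply: le_trans (uB 0%N); rewrite big_geq.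
  apply: (@le_trans _ _ (\sum_(1 <= k < K.+1) pi ^+ 2 * flint_term (Q k))).
    rewrite big_nat [leRHS]big_nat; apply: ler_sum => -[//|k] _.
    exact: cf_term_le_flint_term.
  rewrite -mulr_sumr ler_wpM2l ?sqr_ge0//.
  exact: le_trans (sum_sparse_le _ _ _ flint_term_ge0 Qlt) (uB _).
- exists (\sum_(1 <= n < Q 1) flint_term n + 192 * B) => N.
  have NQ : (N <= Q N.+1)%N.
    rewrite -lez_nat QE; apply: (@le_trans _ _ N.+1%:Z); first by lia.
    by have [] := cf_den_ge N.+1 (fun j => partial_quotient_gt0 j xirr).
  apply: (@le_trans _ _ (\sum_(1 <= n < Q N.+1) flint_term n)).
    have [N0|N1] := leqP N 1%N.
      by rewrite big_geq// sumr_ge0// => n _; exact: flint_term_ge0.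
    rewrite [leRHS](big_cat_nat (ltnW N1) NQ)/= lerDl.
    by rewrite sumr_ge0// => n _; exact: flint_term_ge0.
  apply: le_trans (sum_blocks_le _ (fun k => 192 * cf_term pi^-1 k) Q _ Qlt
    (@sum_flint_block_le R)) _.
  by rewrite lerD2l -mulr_sumr ler_wpM2l.
Qed.
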